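(* Let $As_4^{13}$ be the four-dimensional complex associative algebra with basis $e_1,e_2,e_3,e_4$ and multiplication $e_1\cdot e_1=e_3,\ e_1\cdot e_3=-e_4,\ e_2\cdot e_1=e_4,\ e_2\cdot e_2=e_4,\ e_3\cdot e_1=-e_4$. Any four-dimensional complex anti-dendriform algebra associated to the algebra $As_4^{13}$ is isomorphic to the following algebra on the basis $e_1,e_2,e_3,e_4$ (for some $\alpha,\beta,\gamma\in\mathbb{C}$): $AD_4^{32}(\alpha,\beta,\gamma)$: $e_1\vartriangleright e_1=\frac12 e_3+\alpha e_4,\ e_1\vartriangleright e_2=\beta e_4,\ e_1\vartriangleright e_3=-2e_4,\ e_2\vartriangleright e_1=(1+\beta)e_4,\ e_2\vartriangleright e_2=(1+\gamma)e_4,\ e_3\vartriangleright e_1=e_4,\ e_1\vartriangleleft e_1=\frac12 e_3-\alpha e_4,\ e_1\vartriangleleft e_2=-\beta e_4,\ e_1\vartriangleleft e_3=e_4,\ e_2\vartriangleleft e_1=-\beta e_4,\ e_2\vartriangleleft e_2=-\gamma e_4,\ e_3\vartriangleleft e_1=-2e_4$.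
   Context: All vector spaces and algebras are finite-dimensional over $\mathbb{C}$. An anti-dendriform algebra is a vector space $A$ with two bilinear operations $\vartriangleright,\vartriangleleft: A\otimes A\to A$ such that, writing $x\cdot y=x\vartriangleright y+x\vartriangleleft y$, for all $x,y,z\in A$: $(x\vartriangleright y)\vartriangleleft z=x\vartriangleright(y\vartriangleleft z)$ and $x\vartriangleright(y\vartriangleright z)=-(x\cdot y)\vartriangleright z=-x\vartriangleleft(y\cdot z)=(x\vartriangleleft y)\vartriangleleft z$. Then $(A,\cdot)$ is an associative algebra, called the associated associative algebra of $(A,\vartriangleright,\vartriangleleft)$. An anti-dendriform algebra is ''associated to'' an associative algebra $B$ if its associated associative algebra is $B$ (up to isomorphism). Isomorphisms of anti-dendriform algebras are linear bijections preserving both $\vartriangleright$ and $\vartriangleleft$. In multiplication tables, all products of basis elements that are not listed are zero. *)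

(* Defs.v *)
From HB Require Import structures.
From mathcomp Require Import all_boot all_order all_algebra.
From mathcomp Require Import complex reals.
From mathcomp Require Import ring.

Set Implicit Arguments.
Unset Strict Implicit.
Unset Printing Implicit Defensive.

Import GRing.Theory Num.Theory.

Local Open Scope ring_scope.

Record antiDendriform (K : fieldType) (A : vectType K) := AntiDendriform {
  rhd : {bilinear A -> A -> A};
  lhd : {bilinear A -> A -> A};
  dot := (fun x y => rhd x y + lhd x y) : A -> A -> A;
  rhd_lhdA : forall x y z, lhd (rhd x y) z = rhd x (lhd y z);
  rhd_rhd : forall x y z, rhd x (rhd y z) = - rhd (dot x y) z;
  rhd_dot_lhd : forall x y z, - rhd (dot x y) z = - lhd x (dot y z);
  lhd_lhd : forall x y z, - lhd x (dot y z) = lhd (lhd x y) z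
}.

Definition alg_isomorphic (K : fieldType) (A B : vectType K)
    (mulA : A -> A -> A) (mulB : B -> B -> B) : Prop :=
  exists2 f : 'Hom(A, B), bijective f &
    forall x y, f (mulA x y) = mulB (f x) (f y).

Definition ad_isomorphic (K : fieldType) (A B : vectType K)
    (D : antiDendriform A) (E : antiDendriform B) : Prop :=
  exists f : 'Hom(A, B), [/\ bijective f,
    forall x y, f (rhd D x y) = rhd E (f x) (f y) &
    forall x y, f (lhd D x y) = lhd E (f x) (f y)].

(* The standard basis e_1, ..., e_4 of K^4, indexed from 1. *)
Definition e (K : fieldType) (k : nat) : 'rV[K]_4 := \row_(i < 4) (i.+1 == k)%:R.
Arguments e {K} k.

(* Bilinear extension of e_i, e_j |-> T i j; the indices passed to T run from
   1 to 4. *)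
Definition of_table (K : fieldType) (T : nat -> nat -> 'rV[K]_4)
    (x y : 'rV[K]_4) : 'rV[K]_4 :=
  \sum_(i < 4) \sum_(j < 4) (x 0 i * y 0 j) *: T i.+1 j.+1.

Lemma of_table_is_bilinear (K : fieldType) (T : nat -> nat -> 'rV[K]_4) :
  bilinear_for ( *:%R : K -> 'rV[K]_4 -> 'rV[K]_4) *:%R (of_table T).
Proof.
split=> u c x y; rewrite /= /of_table scaler_sumr -big_split; apply: eq_bigr => i _;
  rewrite scaler_sumr -big_split; apply: eq_bigr => j _ /=;
  rewrite !mxE scalerA -scalerDl; congr (_ *: _); ring.
Qed.

HB.instance Definition _ (K : fieldType) (T : nat -> nat -> 'rV[K]_4) :=
  bilinear_isBilinear.Build K 'rV[K]_4 'rV[K]_4 'rV[K]_4 *:%R *:%R (of_table T)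
    (of_table_is_bilinear T).

Lemma of_tableE (K : fieldType) (T : nat -> nat -> 'rV[K]_4) (i j : 'I_4) :
  of_table T (e i.+1) (e j.+1) = T i.+1 j.+1.
Proof.
rewrite /of_table (bigD1 i) //= (bigD1 j) //= !mxE !eqxx mulr1 scale1r.
rewrite big1 ?addr0 => [|k /negPf kj]; last first.
  by rewrite !mxE eqSS (inj_eq val_inj) kj mulr0 scale0r.
rewrite big1 ?addr0 // => k /negPf ki; rewrite big1 // => l _.
by rewrite !mxE eqSS (inj_eq val_inj) ki mul0r scale0r.
Qed.

Definition As4_13_mul (K : fieldType) : 'rV[K]_4 -> 'rV[K]_4 -> 'rV[K]_4 :=
  of_table (fun i j => match i, j with
    | 1, 1 => e 3
    | 1, 3 => - e 4
    | 2, 1 => e 4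
    | 2, 2 => e 4
    | 3, 1 => - e 4
    | _, _ => 0
    end).
Arguments As4_13_mul {K}.

Definition AD4_32_rhd (K : fieldType) (a b c : K) :
    {bilinear 'rV[K]_4 -> 'rV[K]_4 -> 'rV[K]_4} :=
  of_table (fun i j => match i, j with
    | 1, 1 => 2^-1 *: e 3 + a *: e 4
    | 1, 2 => b *: e 4
    | 1, 3 => - 2 *: e 4
    | 2, 1 => (1 + b) *: e 4
    | 2, 2 => (1 + c) *: e 4
    | 3, 1 => e 4
    | _, _ => 0
    end).

Definition AD4_32_lhd (K : fieldType) (a b c : K) :
    {bilinear 'rV[K]_4 -> 'rV[K]_4 -> 'rV[K]_4} :=
  of_table (fun i j => match i, j with
    | 1, 1 => 2^-1 *: e 3 - a *: e 4
    | 1, 2 => - b *: e 4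
    | 1, 3 => e 4
    | 2, 1 => - b *: e 4
    | 2, 2 => - c *: e 4
    | 3, 1 => - 2 *: e 4
    | _, _ => 0
    end).

Section Expansions.
Variable K : fieldType.
Implicit Types x y z : 'rV[K]_4.

Let i1 : 'I_4 := ord0.
Let i2 : 'I_4 := lift ord0 ord0.
Let i3 : 'I_4 := lift ord0 (lift ord0 ord0).

Ltac expand :=
  rewrite /= /of_table !(big_ord_recl, big_ord0) /=;
  rewrite !(scaler0, addr0, add0r, scalerN, scaleNr, scalerDr, scalerBr, scalerA);
  apply/rowP => k; rewrite !mxE; ring.

Lemma As4_13_mulE x y : As4_13_mul x y =
  (x 0 i1 * y 0 i1) *: e 3 +
  (x 0 i2 * y 0 i1 + x 0 i2 * y 0 i2 - x 0 i1 * y 0 i3 - x 0 i3 * y 0 i1) *: e 4.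
Proof. rewrite /As4_13_mul; expand. Qed.

Lemma AD4_32_rhdE (a b c : K) x y : AD4_32_rhd a b c x y =
  (2^-1 * (x 0 i1 * y 0 i1)) *: e 3 +
  (a * (x 0 i1 * y 0 i1) + b * (x 0 i1 * y 0 i2) - 2 * (x 0 i1 * y 0 i3) +
   (1 + b) * (x 0 i2 * y 0 i1) + (1 + c) * (x 0 i2 * y 0 i2) +
   x 0 i3 * y 0 i1) *: e 4.
Proof. rewrite /AD4_32_rhd; expand. Qed.

Lemma AD4_32_lhdE (a b c : K) x y : AD4_32_lhd a b c x y =
  (2^-1 * (x 0 i1 * y 0 i1)) *: e 3 +
  (- a * (x 0 i1 * y 0 i1) - b * (x 0 i1 * y 0 i2) + x 0 i1 * y 0 i3 -
   b * (x 0 i2 * y 0 i1) - c * (x 0 i2 * y 0 i2) -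
   2 * (x 0 i3 * y 0 i1)) *: e 4.
Proof. rewrite /AD4_32_lhd; expand. Qed.

End Expansions.

Lemma As4_13_mulA (K : fieldType) : associative (@As4_13_mul K).
Proof. by move=> x y z; rewrite !As4_13_mulE; apply/rowP => k; rewrite !mxE /=; ring. Qed.

Section AD4_32.
Variables (K : numFieldType) (a b c : K).

Let r := AD4_32_rhd a b c.
Let l := AD4_32_lhd a b c.

Ltac coords :=
  rewrite /r /l !(AD4_32_rhdE, AD4_32_lhdE); apply/rowP => k; rewrite !mxE /=;
  by field.

Lemma AD4_32_rhd_lhdA x y z : l (r x y) z = r x (l y z).
Proof. coords. Qed.

Lemma AD4_32_rhd_rhd x y z : r x (r y z) = - r (r x y + l x y) z.
Proof. coords. Qed.

Lemma AD4_32_rhd_dot_lhd x y z :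
  - r (r x y + l x y) z = - l x (r y z + l y z).
Proof. coords. Qed.

Lemma AD4_32_lhd_lhd x y z : - l x (r y z + l y z) = l (l x y) z.
Proof. coords. Qed.

Definition AD4_32 : antiDendriform 'rV[K]_4 :=
  AntiDendriform AD4_32_rhd_lhdA AD4_32_rhd_rhd AD4_32_rhd_dot_lhd
    AD4_32_lhd_lhd.

End AD4_32.

(* Main.v *)
Require Import Defs.
From HB Require Import structures.
From mathcomp Require Import all_boot all_order all_algebra.
From mathcomp Require Import complex reals.
From mathcomp Require Import ring.

Set Implicit Arguments.
Unset Strict Implicit.
Unset Printing Implicit Defensive.

Import GRing.Theory Num.Theory.

Local Open Scope ring_scope.

(** Carry the structure over to K^4, where x · y is the product of As_4^13, and
write r for ▷; since ◁ is · minus ▷, only r is unknown.  In terms of r the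
axioms say
  r(xy, z) + r(x, yz) = xyz,   r(x, r(y, z)) = - r(xy, z),
  r(r(x, y), z) = r(x, y)z - xyz.

The first identity is linear in r.  Evaluated on basis vectors it shows that
e4 = e2 e1 = e2 e2 is annihilated by r on both sides, that
r(e2, e3) = r(e3, e2) = r(e3, e3) = 0 and that
r(e1, e3) + r(e3, e1) = - e4.  The two quadratic identities then give
r(e1, e3) = t e4 for a scalar t ([rhd_e1_e3]), and for an arbitrary product
s = r(x, y) they become linear relations between the vectors r(ei, ej), i, j in
{1, 2}, weighted by the coordinates of s ([rhd_product_relations]).  One of
these is s1 (1 + t) = 0.  The value t = -1 contradicts the relations for
s = r(e1, e1), so s1 = 0, then s2 = 0: every product lies in the span of e3 and
e4.  What remains of the relations is t s3 = - x1 y1 together with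
1 + t = -1, so t = -2 and s3 = x1 y1 / 2.

This leaves four free scalars, the e4-coordinates a, b, d, g of r(e1, e1),
r(e1, e2), r(e2, e1) and r(e2, e2), whereas AD_4^32 has three: it requires
d = 1 + b.  The automorphism e1 -> e1 + s e2, e2 -> e2 + s e3,
e3 -> e3 + (s + s^2) e4, e4 -> e4 of As_4^13 changes d - b by 3s up to sign, so a
suitable s makes the difference equal to 1 ([ad_isomorphic_AD4_32]). *)

Local Notation i1 := (ord0 : 'I_4).
Local Notation i2 := (lift ord0 ord0 : 'I_4).
Local Notation i3 := (lift ord0 (lift ord0 ord0) : 'I_4).
Local Notation i4 := (lift ord0 (lift ord0 (lift ord0 ord0)) : 'I_4).

(** * Consequences of the anti-dendriform axioms *)

Section RhdIdentities.
Variables (K : fieldType) (A : vectType K) (D : antiDendriform A).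
Implicit Types x y z : A.

Lemma rhd_dot_add x y z :
  rhd D (dot D x y) z + rhd D x (dot D y z) = dot D x (dot D y z).
Proof. by rewrite (oppr_inj (rhd_dot_lhd D x y z)) addrC. Qed.

(** The common value of the two sides of the first axiom is the triple
product. *)
Lemma rhd_lhd_dot x y z : rhd D x (lhd D y z) = dot D x (dot D y z).
Proof.
have -> : lhd D y z = dot D y z - rhd D y z by rewrite /dot addrC addKr.
by rewrite linearBr rhd_rhd opprK addrC rhd_dot_add.
Qed.

Lemma rhd_rhdl x y z :
  rhd D (rhd D x y) z = dot D (rhd D x y) z - dot D x (dot D y z).
Proof. by rewrite {1}/dot rhd_lhdA rhd_lhd_dot addrK. Qed.

End RhdIdentities.

(** * Transport along linear isomorphisms *)

Section Transport.
Variables (K : fieldType) (A B : vectType K) (f : 'Hom(A, B)) (g : 'Hom(B, A)).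

Definition transport_op (op : {bilinear A -> A -> A}) (x y : B) : B :=
  f (op (g x) (g y)).

Lemma transport_op_is_bilinear op :
  bilinear_for ( *:%R : K -> B -> B) *:%R (transport_op op).
Proof.
by split=> u c x y; rewrite /transport_op /= linearP ?linearPl ?linearPr linearP.
Qed.

HB.instance Definition _ op :=
  bilinear_isBilinear.Build K B B B *:%R *:%R (transport_op op)
    (transport_op_is_bilinear op).

Lemma antiDendriform_transport (D : antiDendriform A) :
  cancel f g -> cancel g f ->
  exists2 E : antiDendriform B,
    forall x y, f (rhd D x y) = rhd E (f x) (f y) &
    forall x y, f (lhd D x y) = lhd E (f x) (f y).
Proof.
move=> fK gK.
pose r : {bilinear B -> B -> B} := transport_op (rhd D).
pose l : {bilinear B -> B -> B} := transport_op (lhd D).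
have dotE x y : r x y + l x y = f (dot D (g x) (g y)) by rewrite linearD.
have ax1 x y z : l (r x y) z = r x (l y z).
  by rewrite /r /l /= /transport_op !fK rhd_lhdA.
have ax2 x y z : r x (r y z) = - r (r x y + l x y) z.
  by rewrite dotE /r /= /transport_op !fK rhd_rhd linearN.
have ax3 x y z : - r (r x y + l x y) z = - l x (r y z + l y z).
  by rewrite !dotE /r /l /= /transport_op !fK -!(linearN f) rhd_dot_lhd.
have ax4 x y z : - l x (r y z + l y z) = l (l x y) z.
  by rewrite !dotE /l /= /transport_op !fK -(linearN f) lhd_lhd.
by exists (AntiDendriform ax1 ax2 ax3 ax4) => x y; rewrite /= /transport_op !fK.
Qed.

End Transport.

Lemma ad_isomorphic_trans (K : fieldType) (A B C : vectType K)
    (D : antiDendriform A) (E : antiDendriform B) (F : antiDendriform C) :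
  ad_isomorphic D E -> ad_isomorphic E F -> ad_isomorphic D F.
Proof.
move=> [f [bf fr fl]] [g [bg gr gl]]; exists (g \o f)%VF; split.
- by apply: (eq_bij (bij_comp bg bf)) => x; rewrite lfunE.
- move=> x y; by rewrite !comp_lfunE fr gr.
- by move=> x y; rewrite !comp_lfunE fl gl.
Qed.

Lemma ad_isomorphic_of_alg (K : fieldType) (A B : vectType K)
    (mulB : B -> B -> B) (D : antiDendriform A) :
  alg_isomorphic (dot D) mulB ->
  exists2 E : antiDendriform B, ad_isomorphic D E & dot E =2 mulB.
Proof.
move=> [f bf fM]; have injf := bij_inj bf.
have kerf : lker f == 0%VS by apply/lker0P.
have fK : cancel f (f^-1)%VF := lker0_lfunK kerf.
have gK : cancel (f^-1)%VF f by move=> y; have [h hK hK'] := bf; rewrite -(hK' y) fK.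
have [E fr fl] := antiDendriform_transport D fK gK.
exists E => [|x y]; first by exists f.
by rewrite -[x]gK -[y]gK -fM {1}/dot -fr -fl -(linearD f).
Qed.

(** * Anti-dendriform structures on the fixed algebra *)

Section Classification.
Variable K : fieldType.

Local Notation V := 'rV[K]_4.
Local Notation M := (@As4_13_mul K).

Lemma e_expand (x : V) :
  x = x 0 i1 *: e 1 + x 0 i2 *: e 2 + x 0 i3 *: e 3 + x 0 i4 *: e 4.
Proof.
apply/rowP; case=> [[|[|[|[|m]]]] km] //; rewrite !mxE /=
  !(mulr0, mulr1, addr0, add0r); congr (x _ _); exact: val_inj.
Qed.

Lemma e_inj (k : 'I_4) (a b : K) : a *: e k.+1 = b *: e k.+1 -> a = b.
Proof. by move/rowP=> /(_ k); rewrite !mxE eqxx !mulr1. Qed.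

Ltac coords := rewrite As4_13_mulE; apply/rowP => k; rewrite !mxE /=; ring.

Lemma M_e : (M (e 1) (e 1) = e 3) * (M (e 1) (e 2) = 0) *
   (M (e 1) (e 3) = - e 4) * (M (e 1) (e 4) = 0) *
   (M (e 2) (e 1) = e 4) * (M (e 2) (e 2) = e 4) *
   (M (e 2) (e 3) = 0) * (M (e 2) (e 4) = 0) *
   (M (e 3) (e 1) = - e 4) * (M (e 3) (e 2) = 0) *
   (M (e 3) (e 3) = 0) * (M (e 3) (e 4) = 0) *
   (M (e 4) (e 1) = 0) * (M (e 4) (e 2) = 0) *
   (M (e 4) (e 3) = 0) * (M (e 4) (e 4) = 0).
Proof.
by do !split; coords.
Qed.

Lemma M_e1l x : M (e 1) x = x 0 i1 *: e 3 - x 0 i3 *: e 4.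
Proof. by coords. Qed.

Lemma M_e2l x : M (e 2) x = (x 0 i1 + x 0 i2) *: e 4.
Proof. by coords. Qed.

Lemma M_e3l x : M (e 3) x = (- x 0 i1) *: e 4.
Proof. by coords. Qed.

Lemma M_e1r x : M x (e 1) = x 0 i1 *: e 3 + (x 0 i2 - x 0 i3) *: e 4.
Proof. by coords. Qed.

Lemma M_e2r x : M x (e 2) = x 0 i2 *: e 4.
Proof. by coords. Qed.

Lemma M_M_e1 x y : M x (M y (e 1)) = (- (x 0 i1 * y 0 i1)) *: e 4.
Proof. by rewrite M_e1r; coords. Qed.

Lemma M_M_e2 x y : M x (M y (e 2)) = 0.
Proof. by rewrite M_e2r; coords. Qed.

Variable E : antiDendriform V.
Hypothesis dotE : dot E =2 M.

Local Notation r := (rhd E).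

Let r_dot x y z : r (M x y) z + r x (M y z) = M x (M y z).
Proof. by rewrite -!dotE rhd_dot_add. Qed.

Let r_r x y z : r x (r y z) = - r (M x y) z.
Proof. by rewrite -dotE rhd_rhd. Qed.

Let r_rl x y z : r (r x y) z = M (r x y) z - M x (M y z).
Proof. by rewrite -!dotE rhd_rhdl. Qed.

Lemma rhd_expandl (s y : V) : r s y = s 0 i1 *: r (e 1) y + s 0 i2 *: r (e 2) y +
  s 0 i3 *: r (e 3) y + s 0 i4 *: r (e 4) y.
Proof. by rewrite {1}[s]e_expand !linearDl !linearZl_LR. Qed.

Lemma rhd_expandr (x s : V) : r x s = s 0 i1 *: r x (e 1) + s 0 i2 *: r x (e 2) +
  s 0 i3 *: r x (e 3) + s 0 i4 *: r x (e 4).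
Proof. by rewrite {1}[s]e_expand !linearDr !linearZr_LR. Qed.

(** These are instances of the identity linear in r on triples of basis vectors,
ordered so that each one determines a single new product. *)
Lemma rhd_sparse : (forall x, r x (e 4) = 0) * (forall x, r (e 4) x = 0) *
  (r (e 2) (e 3) = 0) * (r (e 3) (e 2) = 0) * (r (e 3) (e 3) = 0) *
  (r (e 3) (e 1) = - e 4 - r (e 1) (e 3)).
Proof.
have MN (x y : V) : M x (- y) = - M x y by exact: linearNr.
have M0 (x : V) : M x 0 = 0 by exact: linear0r.
have add0 := (oppr0, addr0, add0r, M0, linear0l r, linear0r r).
have inst i j k := r_dot (e i) (e j) (e k).
have H14 : r (e 1) (e 4) = 0.
  by have := inst 1 2 1; rewrite !M_e !add0.
have H41 : r (e 4) (e 1) = 0.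
  have := inst 1 3 1.
  by rewrite !M_e linearNl linearNr H14 MN M_e !add0 => /eqP; rewrite oppr_eq0 => /eqP.
have H33 : r (e 3) (e 3) = 0.
  by have := inst 1 1 3; rewrite !M_e linearNr MN H14 M_e !add0.
have H23 : r (e 2) (e 3) = 0.
  by have := inst 2 1 1; rewrite !M_e H41 !add0.
have H42 : r (e 4) (e 2) = 0.
  by have := inst 2 1 2; rewrite !M_e !add0.
have H24 : r (e 2) (e 4) = 0.
  by have := inst 2 2 1; rewrite !M_e H41 !add0.
have H43 : r (e 4) (e 3) = 0.
  by have := inst 2 1 3; rewrite !M_e linearNr H24 MN M_e !add0.
have H34 : r (e 3) (e 4) = 0.
  by have := inst 3 2 1; rewrite !M_e !add0.
have H44 : r (e 4) (e 4) = 0.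
  by have := inst 4 2 1; rewrite !M_e !add0.
have H32 : r (e 3) (e 2) = 0.
  by have := inst 1 1 2; rewrite !M_e !add0.
have H31 : r (e 3) (e 1) = - e 4 - r (e 1) (e 3).
  by have := inst 1 1 1; rewrite !M_e => <-; rewrite addrK.
have HR x : r x (e 4) = 0.
  by rewrite rhd_expandl H14 H24 H34 H44 !scaler0 !addr0.
have HL x : r (e 4) x = 0.
  by rewrite rhd_expandr H41 H42 H43 H44 !scaler0 !addr0.
exact: (HR, HL, H23, H32, H33, H31).
Qed.

(** Left multiplication by e1, e2, e3 kills v = r(e1, e3), by the quadratic
identities and r(e3, e3) = r(e4, e3) = 0; this eliminates the coordinates of v
other than the last one by one. *)
Lemma rhd_e1_e3 : exists t, r (e 1) (e 3) = t *: e 4.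
Proof.
set v := r (e 1) (e 3).
have r1v : r (e 1) v = 0 by rewrite r_r !M_e rhd_sparse oppr0.
have r2v : r (e 2) v = 0 by rewrite r_r !M_e rhd_sparse oppr0.
have r3v : r (e 3) v = 0 by rewrite r_r !M_e linearNl rhd_sparse !oppr0.
have vr2 : r v (e 2) = v 0 i2 *: e 4 by rewrite r_rl M_M_e2 subr0 M_e2r.
have v1 : v 0 i1 = 0.
  (* r(e3, v) = v1 r(e3, e1) = - v1 (e4 + v), and v = - e4 also has v1 = 0. *)
  move: r3v; rewrite rhd_expandr !rhd_sparse !scaler0 !addr0 -/v => /eqP.
  rewrite scaler_eq0 => /orP[/eqP // |].
  by rewrite subr_eq0 => /eqP <-; rewrite !mxE /= oppr0.
have v2 : v 0 i2 = 0.
  (* As v1 = 0, both r(v, e2) and r(e2, v) are v2 r(e2, e2). *)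
  apply: (@e_inj i4); rewrite scale0r -vr2 -[RHS]r2v (rhd_expandl v) (rhd_expandr _ v).
  by rewrite v1 !rhd_sparse !scaler0 !scale0r.
have v3 : v 0 i3 = 0.
  move: r1v; rewrite rhd_expandr v1 v2 rhd_sparse !scale0r scaler0 addr0 !add0r -/v.
  by move/eqP; rewrite scaler_eq0 => /orP[/eqP // | /eqP ->]; rewrite mxE.
by exists (v 0 i4); rewrite [LHS]e_expand v1 v2 v3 !scale0r !add0r.
Qed.

Section SquareCoefficient.
Variable t : K.
Hypothesis r13 : r (e 1) (e 3) = t *: e 4.

Lemma rhd_e3l y : r (e 3) y = (- (1 + t) * y 0 i1) *: e 4.
Proof.
rewrite rhd_expandr !rhd_sparse r13 !scaler0 !addr0.
by apply/rowP => k; rewrite !mxE; ring.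
Qed.

(** Any product s = r(x, y) can be multiplied again: on the left by e3, e2, e1,
through r(z, r(x, y)) = - r(zx, y), and on the right by e2, e1, through
r(r(x, y), z) = r(x, y)z - xyz.  Expanding s in the basis turns these into the
five relations below; only the first two coordinates of s meet products that
are still unknown. *)
Lemma rhd_product_relations x y (s := r x y) :
  [/\ s 0 i1 * (1 + t) = 0,
      s 0 i1 *: r (e 2) (e 1) + s 0 i2 *: r (e 2) (e 2) = 0,
      s 0 i1 *: r (e 1) (e 2) + s 0 i2 *: r (e 2) (e 2) = s 0 i2 *: e 4,
      s 0 i1 *: r (e 1) (e 1) + s 0 i2 *: r (e 1) (e 2) =
        ((1 + t) * (x 0 i1 * y 0 i1) - t * s 0 i3) *: e 4 &
      s 0 i1 *: r (e 1) (e 1) + s 0 i2 *: r (e 2) (e 1) =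
        s 0 i1 *: e 3 + (s 0 i2 + t * s 0 i3 + x 0 i1 * y 0 i1) *: e 4].
Proof.
have E1 := r_r (e 1) x y; have E2 := r_r (e 2) x y; have E3 := r_r (e 3) x y.
have F1 := r_rl x y (e 1); have F2 := r_rl x y (e 2).
split.
- move: E3; rewrite M_e3l linearZl_LR rhd_sparse scaler0 oppr0 rhd_e3l => E3.
  apply: (@e_inj i4); rewrite scale0r -[RHS]oppr0 -E3 -scaleNr; congr (_ *: _).
  by ring.
- move: E2; rewrite M_e2l linearZl_LR rhd_sparse scaler0 oppr0.
  by rewrite rhd_expandr !rhd_sparse !scaler0 !addr0.
- move: F2; rewrite M_M_e2 subr0 M_e2r.
  by rewrite rhd_expandl !rhd_sparse !scaler0 !addr0.
- move: E1; rewrite M_e1l linearBl !linearZl_LR rhd_sparse scaler0 subr0 rhd_e3l.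
  rewrite rhd_expandr !rhd_sparse scaler0 addr0 r13 => /(canRL (addrK _)) ->.
  by rewrite !scalerA -scaleNr -scalerBl; congr (_ *: _); ring.
- move: F1; rewrite M_M_e1 M_e1r.
  rewrite (rhd_expandl (r x y)) rhd_e3l rhd_sparse scaler0 addr0 => /(canRL (addrK _)) ->.
  by apply/rowP => k; rewrite !mxE /=; ring.
Qed.

(** If t = -1, the relations for u = r(e1, e1) express both u1 (w - p) and
u2 (w - p), where w = r(e1, e2) and p = r(e2, e1).  Comparing u2 times the former
with u1 times the latter in the third coordinate gives u1^2 = 0; then u2 = 0,
u3 = 0, and the last relation reads 0 = e4. *)
Lemma coef13_neqN1 : 1 + t != 0.
Proof.
apply/eqP => t1; have [_ E2 F2 E1 F1] := rhd_product_relations (e 1) (e 1).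
have tN1 : t = - 1 by apply/eqP; rewrite -addr_eq0 addrC t1.
set u := r (e 1) (e 1) in E2 F2 E1 F1.
move: E1 F1; rewrite t1 tN1 !mxE /= mul0r sub0r !mulN1r opprK mulr1 => E1 F1.
have wp1 : u 0 i1 *: (r (e 1) (e 2) - r (e 2) (e 1)) = u 0 i2 *: e 4.
  by rewrite -F2 -[LHS]addr0 -[in LHS]E2; apply/rowP => k; rewrite !mxE; ring.
have wp2 : u 0 i2 *: (r (e 1) (e 2) - r (e 2) (e 1)) =
    (u 0 i3) *: e 4 - (u 0 i1 *: e 3 + (u 0 i2 - u 0 i3 + 1) *: e 4).
  by rewrite -E1 -F1; apply/rowP => k; rewrite !mxE; ring.
have u1 : u 0 i1 = 0.
  have : u 0 i2 *: (u 0 i2 *: e 4) =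
    u 0 i1 *: (u 0 i2 *: (r (e 1) (e 2) - r (e 2) (e 1))).
    by rewrite -wp1 !scalerA mulrC.
  rewrite wp2 => /rowP /(_ i3); rewrite !mxE /= => /eqP.
  rewrite !mulr0 mulr1 addr0 add0r mulrN eq_sym oppr_eq0 mulf_eq0 orbb => /eqP //.
have u2 : u 0 i2 = 0 by apply: (@e_inj i4); rewrite -wp1 u1 !scale0r.
move: E1 F1; rewrite u1 u2 !scale0r addr0 !add0r => E1 F1.
have u3 : u 0 i3 = 0 by apply: (@e_inj i4); rewrite -E1 scale0r.
have := @e_inj i4 0 1; rewrite scale0r scale1r F1 u3 oppr0 add0r scale1r.
by move=> /(_ erefl)/eqP; rewrite eq_sym oner_eq0.
Qed.

(** Since s1 = 0, the second and third relations evaluate the same vector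
s2 r(e2, e2) to 0 and to s2 e4. *)
Lemma rhd_coords12 x y : (r x y 0 i1 = 0) * (r x y 0 i2 = 0).
Proof.
have [E3 E2 F2 _ _] := rhd_product_relations x y.
have s1 : r x y 0 i1 = 0.
  by apply/eqP; move/eqP: E3; rewrite mulf_eq0 (negPf coef13_neqN1) orbF.
split=> //; apply: (@e_inj i4); rewrite -F2 scale0r -[RHS]E2.
by rewrite s1 !scale0r.
Qed.

Lemma rhd_coord3 x y : t * r x y 0 i3 = - (x 0 i1 * y 0 i1).
Proof.
have [_ _ _ _] := rhd_product_relations x y.
rewrite !rhd_coords12 !scale0r !add0r -[LHS](scale0r (e 4)) => /(@e_inj i4 0 _).
by move/eqP; rewrite eq_sym addr_eq0 => /eqP.
Qed.

(** For x = y = e1 the fourth relation equates (1 + t) - t s3 to 0, where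
t s3 = -1. *)
Lemma coef13_eqN2 : t = - 2.
Proof.
have [_ _ _ + _] := rhd_product_relations (e 1) (e 1).
rewrite rhd_coord3 !rhd_coords12 !scale0r addr0 !mxE /= !mulr1 opprK.
rewrite -[LHS](scale0r (e 4)) => /(@e_inj i4 0 _) t2.
by apply/eqP; rewrite -subr_eq0 t2; apply/eqP; ring.
Qed.

End SquareCoefficient.

Lemma rhd_classification : (2 : K) != 0 -> exists a b d g, forall x y, r x y =
  (2^-1 * (x 0 i1 * y 0 i1)) *: e 3 +
  (a * (x 0 i1 * y 0 i1) + b * (x 0 i1 * y 0 i2) - 2 * (x 0 i1 * y 0 i3) +
   d * (x 0 i2 * y 0 i1) + g * (x 0 i2 * y 0 i2) + x 0 i3 * y 0 i1) *: e 4.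
Proof.
move=> nz2; have [t r13] := rhd_e1_e3.
have s12 := rhd_coords12 r13; have s3 := rhd_coord3 r13.
have t2 := coef13_eqN2 r13.
have s3E x y : r x y 0 i3 = 2^-1 * (x 0 i1 * y 0 i1).
  by apply: (mulfI nz2); rewrite mulVKf // -[RHS]opprK -s3 t2 mulNr opprK.
exists (r (e 1) (e 1) 0 i4), (r (e 1) (e 2) 0 i4), (r (e 2) (e 1) 0 i4),
  (r (e 2) (e 2) 0 i4) => x y.
rewrite [LHS]e_expand !s12 !scale0r !add0r s3E; congr (_ + _ *: _).
rewrite rhd_expandl !(rhd_expandr _ y) !rhd_sparse r13 t2 !mxE /=; ring.
Qed.

End Classification.

(** * Normal form up to automorphism *)

Section Normalisation.
Variables (K : fieldType) (s : K).

Local Notation V := 'rV[K]_4.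

(** The automorphism of As_4^13 with e1 -> e1 + s e2, e2 -> e2 + s e3: it has to
send e3 = e1 e1 to (e1 + s e2)(e1 + s e2) = e3 + (s + s^2) e4, and the
s e3 in the image of e2 restores e1 e2 = 0. *)
Definition shear (x : V) : V :=
  x + (s * x 0 i1) *: e 2 + (s * x 0 i2) *: e 3 + ((s + s ^+ 2) * x 0 i3) *: e 4.

Definition shear_inv (x : V) : V :=
  let x2 := x 0 i2 - s * x 0 i1 in
  let x3 := x 0 i3 - s * x2 in
  x 0 i1 *: e 1 + x2 *: e 2 + x3 *: e 3 + (x 0 i4 - (s + s ^+ 2) * x3) *: e 4.

Lemma shear_is_linear : linear shear.
Proof. by move=> c x y; apply/rowP => k; rewrite /shear !mxE; ring. Qed.

HB.instance Definition _ := GRing.isLinear.Build K V V *:%R shear shear_is_linear.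

Lemma shear_bij : bijective shear.
Proof.
by exists shear_inv => x; rewrite [RHS]e_expand /shear /shear_inv;
  apply/rowP => k; rewrite !mxE /=; ring.
Qed.

Lemma shear_M x y : shear (As4_13_mul x y) = As4_13_mul (shear x) (shear y).
Proof.
by rewrite !As4_13_mulE /shear; apply/rowP => k; rewrite !mxE /=; ring.
Qed.

End Normalisation.

Lemma AD4_32_dot (K : numFieldType) (a b c : K) : dot (AD4_32 a b c) =2 As4_13_mul.
Proof.
move=> x y; rewrite /dot /= AD4_32_rhdE AD4_32_lhdE As4_13_mulE.
by apply/rowP => k; rewrite !mxE; field.
Qed.

Lemma ad_isomorphic_AD4_32 (K : numFieldType) (E : antiDendriform 'rV[K]_4) :
  dot E =2 As4_13_mul -> exists a b c, ad_isomorphic E (AD4_32 a b c).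
Proof.
move=> dotE.
have [|a [b [d [g rE]]]] := rhd_classification dotE; first by rewrite pnatr_eq0.
(* Pulling AD_4^32(a', b', c) back along the shear gives r(e1, e2) and r(e2, e1)
   the coefficients b' + s c - s and 1 + b' + s (1 + c) + s, whose difference is
   1 + 3 s; this determines s, and then b' and a' are read off from r(e1, e2)
   and r(e1, e1). *)
pose s := (d - b - 1) / 3; pose c := g - 1; pose b' := b - s * c + s.
pose a' := a + 2^-1 * (s + s ^+ 2) - s * (1 + 2 * b') - s ^+ 2 * g.
exists a', b', c, (linfun (shear s)).
have shear_rhd x y : shear s (rhd E x y) = AD4_32_rhd a' b' c (shear s x) (shear s y).
  rewrite rE AD4_32_rhdE /shear; apply/rowP => k; rewrite !mxE /= /a' /b' /s /c.
  by field.
split=> [|x y|x y].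
- by apply: (eq_bij (shear_bij s)) => x; rewrite lfunE.
- by rewrite !lfunE /= shear_rhd.
rewrite !lfunE /=.
have lhdE (F : antiDendriform 'rV[K]_4) u v : lhd F u v = dot F u v - rhd F u v.
  by rewrite /dot addrC addKr.
rewrite lhdE linearB /= dotE shear_M shear_rhd -(AD4_32_dot a' b' c).
exact/esym/(lhdE (AD4_32 a' b' c)).
Qed.

Theorem theorem3p6 (R : realType) (A : vectType R[i]) (D : antiDendriform A) :
  \dim (fullv : {vspace A}) = 4%N ->
  alg_isomorphic (dot D) As4_13_mul ->
  exists alpha beta gamma : R[i], ad_isomorphic D (AD4_32 alpha beta gamma).
Proof.
move=> _ /ad_isomorphic_of_alg[E DE /ad_isomorphic_AD4_32[a [b [c Eabc]]]].
by exists a, b, c; apply: ad_isomorphic_trans DE Eabc.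
Qed.
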